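(* Let $\triangle$ be the Sierpiński gasket, let $f\in C(\triangle,\mathbb{R})$, let $\alpha\in\mathbb{R}^3$ be a scale vector with $|\alpha|_\infty<1$, and let $X_f=\{b\in C(\triangle,\mathbb{R}) : b|_{V_0}=f|_{V_0}\}$. Then the map $T:X_f\to C(\triangle,\mathbb{R})$ defined by $T(b)=f_b^\alpha$ is Lipschitz continuous (with respect to the uniform norm), where $f_b^\alpha$ is the $\alpha$-fractal function associated with $f$ with respect to the base function $b$ and the scale vector $\alpha$.
   Context: Let $V_0=\{x_1,x_2,x_3\}\subset\mathbb{R}^2$ be a set of three distinct points with equal pairwise distances (the vertices of an equilateral triangle). For $i=1,2,3$ let $u_i:\mathbb{R}^2\to\mathbb{R}^2$, $u_i(t)=\frac12(t+x_i)$. The Sierpiński gasket $\triangle$ is the attractor of this iterated function system, i.e. the unique nonempty compact set with $\triangle=\bigcup_{i=1}^3 u_i(\triangle)$. $C(\triangle,\mathbb{R})$ denotes the space of continuous real-valued functions on $\triangle$, equipped with the uniform norm $\|g\|_\infty=\sup_{t\in\triangle}|g(t)|$; $X_f$ carries the induced metric. For $\alpha=(\alpha_1,\alpha_2,\alpha_3)\in\mathbb{R}^3$, $|\alpha|_\infty=\max_i|\alpha_i|$. Given $f\in C(\triangle,\mathbb{R})$ (original function), $b\in C(\triangle,\mathbb{R})$ (base function) with $b|_{V_0}=f|_{V_0}$, and a scale vector $\alpha\in\mathbb{R}^3$ with $|\alpha|_\infty<1$, the $\alpha$-fractal function $f_b^\alpha$ is the unique continuous function $\triangle\to\mathbb{R}$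 satisfying $$f_b^\alpha(t)=f(t)+\alpha_i\,(f_b^\alpha-b)(u_i^{-1}(t))\quad\text{for all } t\in u_i(\triangle),\ i\in\{1,2,3\}.$$ (Its graph is the attractor of the iterated function system on $\triangle\times\mathbb{R}$ given by the maps $H_i(t,x)=(u_i(t),\ \alpha_i x+f(u_i(t))-\alpha_i b(t))$, $i=1,2,3$. The existence and uniqueness of $f_b^\alpha$ is a known result.) *)

(* Defs.v *)
From HB Require Import structures.
From mathcomp Require Import all_boot all_order all_algebra.
From mathcomp Require Import all_classical all_reals all_analysis.

Set Implicit Arguments.
Unset Strict Implicit.
Unset Printing Implicit Defensive.

Import Order.TTheory GRing.Theory Num.Theory.
Import numFieldNormedType.Exports.

Local Open Scope classical_set_scope.
Local Open Scope ring_scope.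

(* The library norm on 'rV[R]_2 is the maximum norm; it induces the usual
   topology of the plane, but the triangle is equilateral for the Euclidean
   distance. *)
Definition euclidean_dist (R : realType) (s t : 'rV[R]_2) : R :=
  Num.sqrt (\sum_(k < 2) (s 0 k - t 0 k) ^+ 2).

Definition equilateral (R : realType) (x : 'I_3 -> 'rV[R]_2) : Prop :=
  injective x /\
  exists d : R, forall i j : 'I_3, i != j -> euclidean_dist (x i) (x j) = d.

Definition gasket_map (R : realType) (x : 'I_3 -> 'rV[R]_2) (i : 'I_3)
    (t : 'rV[R]_2) : 'rV[R]_2 :=
  2^-1 *: (t + x i).

Definition sierpinski_gasket (R : realType) (x : 'I_3 -> 'rV[R]_2)
    (D : set 'rV[R]_2) : Prop :=
  [/\ D !=set0, compact D & D = \bigcup_i (gasket_map x i @` D)].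

Definition Cfun (R : realType) (D : set 'rV[R]_2) :=
  continuousType (set_type D) R.

Definition sup_norm (R : realType) (D : set 'rV[R]_2) (g : D -> R) : R :=
  sup (range (fun t : D => `|g t|)).

(* X_f: the vertices x i are fixed points of the maps, hence lie in the gasket,
   so that the condition below does constrain b at each of them. *)
Definition base_functions (R : realType) (x : 'I_3 -> 'rV[R]_2)
    (D : set 'rV[R]_2) (f : Cfun D) : set (Cfun D) :=
  [set b | forall t : D, range x (\val t) -> b t = f t].

(* [g] is the fractal function of [f] with base function [b] and scale vector
   [alpha].  The maps are injective, so for t in gasket_map x i @` D the point
   s of D with gasket_map x i s = t is the preimage of t. *)
Definition is_fractal_function (R : realType) (x : 'I_3 -> 'rV[R]_2)
    (D : set 'rV[R]_2) (f b : Cfun D) (alpha : 'rV[R]_3) (g : Cfun D) : Prop :=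
  forall (i : 'I_3) (t s : D), gasket_map x i (\val s) = \val t ->
    g t = f t + alpha 0 i * (g s - b s).

(* Main.v *)
Require Import Defs.
From mathcomp Require Import all_boot all_order all_algebra.
From mathcomp Require Import all_classical all_reals all_analysis.
From mathcomp Require Import lra.

Import Order.TTheory GRing.Theory Num.Theory.
Import numFieldNormedType.Exports.

Local Open Scope classical_set_scope.
Local Open Scope ring_scope.

(** The difference h of two fractal functions with base functions b and c
satisfies h(u_i(s)) = alpha_i (h - (b - c))(s), so that
|h| <= |alpha| (|h| + |b - c|) in the uniform norm. As |h| is finite by
compactness, |alpha| / (1 - |alpha|) is a Lipschitz constant. *)

Lemma compact_has_ubound_norm (R : realType) (X : topologicalType) (A : set X)
    (g : A -> R) :
  compact A -> continuous g -> has_ubound (range (fun t : A => `|g t|)).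
Proof.
move=> cA cg.
have cn : continuous (fun t : A => `|g t|).
  by move=> t; apply: continuous_comp; [exact: cg|exact: norm_continuous].
(* Extending by 0 off [A] gives a function on [X] that is continuous on the subspace [A], so the
   image of the compact set [A] is bounded. *)
have cV := (subspace_valL_continuousP' A 0 _).2 cn.
have /compact_bounded[M [_ /(_ (M + 1))]] := continuous_compact cV cA.
rewrite ltrDl ltr01 => /(_ isT) MV.
exists (M + 1) => _ [t _ <-]; apply: le_trans (ler_norm _) _.
apply: MV; exists (\val t); first exact: set_valP.
exact: (congr1 (@^~ t) (valLK 0 (fun s : A => `|g s|))).
Qed.

Lemma mx_entry_norm_le (R : realDomainType) m n (A : 'M[R]_(m, n)) i j :
  `|A i j| <= `|A|.
Proof.
rewrite [leRHS]mx_normrE.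
exact: (le_bigmax _ (fun ij => `|A ij.1 ij.2|) (i, j)).
Qed.

(* `|alpha| is the maximum norm of the row vector alpha. *)
Theorem theorem3p2 (R : realType) (x : 'I_3 -> 'rV[R]_2)
    (D : set 'rV[R]_2) (f : Cfun D) (alpha : 'rV[R]_3)
    (T : base_functions x f -> Cfun D) :
  equilateral x ->
  sierpinski_gasket x D ->
  `|alpha| < 1 ->
  (forall b : base_functions x f,
     is_fractal_function x f (\val b) alpha (T b)) ->
  exists2 K : R, 0 <= K &
    forall b c : base_functions x f,
      sup_norm (fun t : D => T b t - T c t) <=
      K * sup_norm (fun t : D => (\val b : Cfun D) t - (\val c : Cfun D) t).
Proof.
move=> _ [[t0 Dt0] cD DE] alpha1 Tfractal.
have alphaB : 0 < 1 - `|alpha| by rewrite subr_gt0.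
exists (`|alpha| / (1 - `|alpha|)) => [|b c]; first exact: divr_ge0 (ltW alphaB).
(* Compactness matters here: [sup] of an unbounded set is the default 0, which bounds nothing. *)
have le_sup (g h : Cfun D) t : `|g t - h t| <= sup_norm (fun t => g t - h t).
  apply: ub_le_sup; last by exists t.
  apply: (@compact_has_ubound_norm R _ D (fun t : D => g t - h t)) => // s.
  by apply: continuousB; exact: cts_fun.
set H := sup_norm (fun t => T b t - T c t).
set K := sup_norm (fun t => _ - _).
suff HK : H <= `|alpha| * (H + K).
  by rewrite mulrAC ler_pdivlMr//; lra.
apply: ge_sup => [|_ [t _ <-]].
  by eexists; exists (exist _ t0 (mem_set Dt0)).
have : D (\val t) by exact: set_valP.
(* By self-similarity t = u_i(s). Both functional equations are used at this same pair (i, s), so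
   [f t] cancels. *)
rewrite {1}DE => -[i _ [s Ds st]].
pose s' : D := exist _ s (mem_set Ds).
rewrite (Tfractal b i t s' st) (Tfractal c i t s' st).
rewrite opprD addrACA subrr add0r -mulrBr normrM.
apply: ler_pM => //; first exact: mx_entry_norm_le.
(* Regroup as (T b - T c)(s) - (b - c)(s), to be bounded by [H] + [K]. *)
rewrite opprD addrACA -opprD; apply: le_trans (ler_normB _ _) _.
by apply: lerD; exact: le_sup.
Qed.
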